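(* Let $m,n\ge 1$ and let $\mathcal{H}=\mathbb{R}^{m\times n}$ with matrix inner product $\langle \mathbf{A},\mathbf{B}\rangle_{\mathcal{H}}=\mathbf{A}^\intercal\mathbf{B}\in\mathbb{R}^{n\times n}$. Let $\mathbf{V}\in\mathbb{R}^{n\times n}$ be a nonzero symmetric matrix such that $\langle \langle \mathbf{X},\mathbf{X}\rangle_{\mathcal{H}},\mathbf{V}/\|\mathbf{V}\|\rangle\ge 0$ for all $\mathbf{X}\in\mathcal{H}$, and set $\|\mathbf{X}\|_{\mathcal{H}}(\mathbf{V})=\big(\langle \mathbf{X}^\intercal\mathbf{X},\mathbf{V}/\|\mathbf{V}\|\rangle\big)^{1/2}$. Let $\mathcal{Y}$ be a label set and let $\mathcal{D}$ be a distribution over $\mathcal{H}\times\mathcal{Y}$ such that with probability $1$ we have $\|\mathbf{X}\|_{\mathcal{H}}(\mathbf{V})\le R'$. Let $\mathcal{H}'_p=\{\mathbf{W}'\in\mathcal{H}:\|\mathbf{W}'\|_{\mathcal{H}}(\mathbf{V})\le B'\}$ and let $\ell:\mathcal{H}'_p\times(\mathcal{H}\times\mathcal{Y})\to\mathbb{R}$ be a loss of the form $$\ell(\mathbf{W}',(\mathbf{X},y))=\Phi\Big(\big\langle \langle\mathbf{W}',\mathbf{X}\rangle_{\mathcal{H}},\tfrac{\mathbf{V}}{\|\mathbf{V}\|}\big\rangle,y\Big),$$ where for every $y\in\mathcal{Y}$ the map $a\mapsto\Phi(a,y)$ is $\rho$-Lipschitz and $\max_{a\in[-B'R',B'R']}|\Phi(a,y)|\le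 c'$. Then for any $\delta\in(0,1)$, with probability at least $1-\delta$ over the choice of an i.i.d. sample $\mathcal{S}$ of size $N$ from $\mathcal{D}$, $$\forall\,\mathbf{W}'\in\mathcal{H}'_p:\quad L_{\mathcal{D}}(\mathbf{W}')\le L_{\mathcal{S}}(\mathbf{W}')+\frac{2\rho B'R'}{\sqrt N}+c'\sqrt{\frac{2\ln(2/\delta)}{N}}.$$
   Context: For matrices $\mathbf{A},\mathbf{B}$ of the same size, $\langle\mathbf{A},\mathbf{B}\rangle=\sum_{i,j}a_{ij}b_{ij}$ is the Frobenius inner product and $\|\mathbf{A}\|$ the Frobenius norm. For a sample $\mathcal{S}=((\mathbf{X}_1,y_1),\dots,(\mathbf{X}_N,y_N))$, $L_{\mathcal{S}}(\mathbf{W}')=\frac1N\sum_{i=1}^N\ell(\mathbf{W}',(\mathbf{X}_i,y_i))$ is the empirical loss and $L_{\mathcal{D}}(\mathbf{W}')=\mathbb{E}_{(\mathbf{X},y)\sim\mathcal{D}}[\ell(\mathbf{W}',(\mathbf{X},y))]$ is the true loss. *)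

(* Defs.v *)
From HB Require Import structures.
From mathcomp Require Import all_boot all_order all_algebra.
From mathcomp Require Import all_classical all_reals all_analysis.
Set Implicit Arguments. Unset Strict Implicit. Unset Printing Implicit Defensive.
Import Order.TTheory GRing.Theory Num.Theory.
Local Open Scope classical_set_scope.
Local Open Scope ring_scope.

Definition frob_inner (R : realType) (p q : nat) (A B : 'M[R]_(p, q)) : R :=
  \sum_(i < p) \sum_(j < q) A i j * B i j.

Definition frob_norm (R : realType) (p q : nat) (A : 'M[R]_(p, q)) : R :=
  Num.sqrt (frob_inner A A).

Definition H_inner (R : realType) (m n : nat) (A B : 'M[R]_(m, n)) : 'M[R]_n :=
  A^T *m B.

Definition Vnormalized (R : realType) (n : nat) (V : 'M[R]_n) : 'M[R]_n :=
  (frob_norm V)^-1 *: V.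

Definition H_norm (R : realType) (m n : nat) (V : 'M[R]_n) (X : 'M[R]_(m, n)) : R :=
  Num.sqrt (frob_inner (H_inner X X) (Vnormalized V)).

(* Z_0, ..., Z_{N-1} : Omega -> T form an i.i.d. sample from D under P:
   each Z_i is measurable with law D, and they are mutually independent
   (product rule for every family of measurable sets; subfamilies are
   obtained by taking A_i = setT). *)
Definition iid_sample (R : realType) (d dT : measure_display)
  (Omega : measurableType d) (T : measurableType dT)
  (P : probability Omega R) (D : probability T R) (N : nat)
  (Z : 'I_N -> Omega -> T) : Prop :=
  [/\ (forall i, measurable_fun setT (Z i)),
      (forall i (A : set T), measurable A -> P (Z i @^-1` A) = D A) &
      (forall A : 'I_N -> set T, (forall i, measurable (A i)) ->
         P (\bigcap_(i in [set: 'I_N]) (Z i @^-1` A i)) =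
         (\prod_(i < N) P (Z i @^-1` A i))%E)].

(* Main.v *)
(* The pairing <<W, X>_H, V/|V|> is a positive semidefinite symmetric bilinear
   form, so Cauchy-Schwarz holds and the loss is Lipschitz in W for the
   seminorm H_norm V. It therefore suffices to control a sequence dense in the
   ball, hence (by continuity from below) finitely many predictors. Quantizing
   the finitely many losses reduces the law D to one on a finite alphabet, where
   expectations over samples are iterated finite sums.

   On a finite alphabet the uniform deviation F has bounded differences 2 c'/N,
   and McDiarmid's inequality gives the term c' sqrt(2 ln(2/delta)/N). To bound
   the mean of F, the sup is averaged one observation at a time: such averages
   [shift_avg] commute, so it is enough to trade a single centred observation
   for a Rademacher sign (symmetrization, by convexity of the maximum) and then
   the loss for a linear functional (contraction). What remains is the
   Rademacher average of a ball, at most 2 rho B' R' / sqrt N. *)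

Require Import Defs.
From HB Require Import structures.
From mathcomp Require Import all_boot all_order all_algebra.
From mathcomp Require Import all_classical all_reals all_analysis.
From mathcomp Require Import measurable_realfun ring lra.
Set Implicit Arguments. Unset Strict Implicit. Unset Printing Implicit Defensive.
Import Order.TTheory GRing.Theory Num.Theory.
Import numFieldNormedType.Exports.
Local Open Scope classical_set_scope.
Local Open Scope ring_scope.

(** * Hoeffding's lemma *)

Lemma expR_chord (R : realType) (x q : R) : 0 <= q <= 1 ->
  expR (q * x) <= 1 - q + q * expR x.
Proof.
move=> q01.
have := @convex_expR R (Itv01 (andP q01).1 (andP q01).2) x 0.
rewrite !convRE /= expR0 mulr0 addr0 mulr1.
by rewrite addrC.
Qed.

(** After taking logarithms, [phi] is the difference of the two exponents and vanishes at 0. Its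
    derivative [chi] also vanishes at 0 and is nondecreasing, because the log-moment generating
    function of a Bernoulli variable has second derivative at most 1/4. *)
Lemma bernoulli_mgf_le (R : realType) (q x : R) : 0 <= q <= 1 -> 0 <= x ->
  1 - q + q * expR x <= expR (q * x + x ^+ 2 / 8).
Proof.
move=> /andP[q0 q1] x0.
pose Q (y : R) : R := 1 - q + q * expR y.
have Qpos y : 0 < Q y.
  rewrite /Q; have e0 := expR_gt0 y.
  have [->|qn0] := eqVneq q 0; first by rewrite subr0 mul0r addr0 ltr01.
  have : 0 < q by rewrite lt0r qn0.
  by move=> q0'; nra.
have dQ (y : R) : is_derive y 1 Q (q * expR y).
  rewrite /Q.
  apply: is_derive_eq.
  by rewrite /GRing.scale /=; ring.
pose chi (y : R) : R := q + y / 4 - q * expR y / Q y.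
have dchi (y : R) : is_derive y 1 chi (4^-1 - q * (1 - q) * expR y / Q y ^+ 2).
  have Qn0 : Q y != 0 by rewrite gt_eqF.
  have dV := @is_deriveV R Q y _ 1 Qn0 (dQ y).
  rewrite /chi; apply: is_derive_eq.
  rewrite /GRing.scale /=.
  rewrite /Q; field; exact: Qn0.
have chi_ge0 y : 0 <= y -> 0 <= chi y.
  move=> y0.
  have -> : 0 = chi 0 by rewrite /chi /Q expR0 mul0r addr0 mulr1 subrK divr1 subrr.
  apply: (@ger0_derive1_ndecry R chi 0) => //.
  - move=> z _; rewrite derive1E derive_val.
    (* The square completed below is [Q^2 - 4 q (1 - q) e^z = (1 - q - q e^z)^2]. *)
    rewrite subr_ge0 ler_pdivrMr ?exprn_gt0 //.
    rewrite /Q; have := sqr_ge0 (1 - q - q * expR z); lra.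
  - apply: continuous_subspaceT => z.
    by apply/differentiable_continuous/derivable1_diffP.
pose phi (y : R) : R := q * y + y ^+ 2 / 8 - ln (Q y).
have dphi (y : R) : is_derive y 1 phi (chi y).
  have dl := @is_derive1_ln R (Q y) (Qpos y).
  have dc : is_derive y 1 (fun t => ln (Q t)) ((Q y)^-1 * (q * expR y)).
    exact: (@is_derive1_comp R (@ln R) Q).
  rewrite /phi; apply: is_derive_eq.
  by rewrite /GRing.scale /= /chi; field; rewrite gt_eqF.
have : phi 0 <= phi x.
  apply: (@ger0_derive1_ndecry R phi 0) => //.
  - move=> z; rewrite in_itv/= andbT => /ltW z0.
    by rewrite derive1E derive_val chi_ge0.
  - apply: continuous_subspaceT => z.
    by apply/differentiable_continuous/derivable1_diffP.
rewrite /phi /Q expR0 mulr1 subrK ln1 mulr0 expr0n /= mul0r addr0 subr0 => h.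
rewrite -/(Q x) -[leLHS](@lnK R) ?posrE // ler_expR.
by rewrite /Q; lra.
Qed.

Lemma pmf_inhabited (R : realType) (A : finType) (p : A -> R) :
  \sum_a p a = 1 -> A.
Proof.
move=> p1; case: (pickP (predT : pred A)) => [//|A0]; exfalso; move: p1.
by rewrite big_pred0 // => /esym/eqP; rewrite oner_eq0.
Qed.

(** By convexity, pushing the mass of [h] to the endpoints [h b] and [h b + w], with the mean kept,
    can only raise the exponential moment. The resulting two-point law is the Bernoulli case. *)
Lemma hoeffding_lemma (R : realType) (A : finType) (p h : A -> R) (w : R) :
  (forall a, 0 <= p a) -> \sum_a p a = 1 ->
  (forall a b, h a - h b <= w) ->
  \sum_a p a * expR (h a) <= expR (\sum_a p a * h a + w ^+ 2 / 8).
Proof.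
move=> p0 p1 hw.
have a0 := pmf_inhabited p1.
have [b _ hb] := arg_minP (P := predT) h (i0 := a0) isT.
have w0 : 0 <= w by have := hw a0 a0; rewrite subrr.
(* For [w = 0] the quotient is 0 by convention, and [hE] survives because [h] is then constant. *)
pose th a := (h a - h b) / w.
have th01 a : 0 <= th a <= 1.
  rewrite /th; have := hb a isT; have := hw a b.
  have [->|wn0] := eqVneq w 0; first by rewrite invr0 mulr0 lexx ler01.
  have wp : 0 < w by rewrite lt0r wn0.
  move=> h1 h2; rewrite divr_ge0 ?subr_ge0 //=.
  by rewrite ler_pdivrMr // mul1r.
have hE a : h a = h b + th a * w.
  rewrite /th; have [w00|wn0] := eqVneq w 0; last by rewrite divfK // addrC subrK.
  rewrite w00 mulr0 addr0; apply/eqP; rewrite eq_le (hb a isT) andbT.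
  by have := hw a b; rewrite w00 subr_le0.
pose q := \sum_a p a * th a.
have q01 : 0 <= q <= 1.
  apply/andP; split.
    by apply: sumr_ge0 => a _; rewrite mulr_ge0 //; case/andP: (th01 a).
  rewrite -p1; apply: ler_sum => a _; rewrite -[leRHS]mulr1 ler_wpM2l //.
  by case/andP: (th01 a).
have qE : \sum_a p a * h a = h b + q * w.
  under eq_bigr do rewrite hE mulrDr mulrA.
  by rewrite big_split /= -!mulr_suml p1 mul1r.
rewrite qE -addrA expRD.
apply: (@le_trans _ _ (expR (h b) * (1 - q + q * expR w))); last first.
  by rewrite ler_wpM2l ?expR_ge0 // bernoulli_mgf_le.
apply: (@le_trans _ _ (\sum_a p a * (expR (h b) * (1 - th a + th a * expR w)))).
  apply: ler_sum => a _; rewrite ler_wpM2l // hE expRD ler_wpM2l ?expR_ge0 //.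
  exact: expR_chord.
under eq_bigr do rewrite mulrCA.
rewrite -mulr_sumr ler_wpM2l ?expR_ge0 //.
under eq_bigr do rewrite mulrDr mulrBr mulr1 [_ * (_ * expR w)]mulrA.
by rewrite big_split /= sumrB p1 -mulr_suml.
Qed.

(** * Iterated expectations over a finite alphabet *)

(** The mean over [n] independent letters of law [p]. Taking [F] on lists of any length lets the
    recursion peel off one letter without dependent types; only lists of length [n] are
    evaluated. *)
Fixpoint seq_expect (R : realType) (A : finType) (p : A -> R) (n : nat)
    (F : seq A -> R) : R :=
  if n is n'.+1 then \sum_a p a * seq_expect p n' (fun s => F (a :: s))
  else F [::].

Section seq_expect_theory.
Variables (R : realType) (A : finType) (p : A -> R).
Hypotheses (p_ge0 : forall a, 0 <= p a) (p_sum1 : \sum_a p a = 1).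

Lemma seq_expect_tuple (n : nat) (F : seq A -> R) :
  seq_expect p n F = \sum_(s : n.-tuple A) F s * \prod_(i < n) p (tnth s i).
Proof.
elim: n F => [|n IH] F /=.
  rewrite (bigD1 [tuple]) //= big_ord0 mulr1 big1 ?addr0 // => s.
  by move=> /eqP[]; rewrite tuple0.
under eq_bigr do rewrite IH mulr_sumr.
rewrite pair_big /=.
rewrite [RHS](reindex (fun x : A * n.-tuple A => [tuple of x.1 :: x.2])) /=.
  apply: eq_bigr => -[a s] _ /=.
  rewrite big_ord_recl tnth0 mulrCA; congr (_ * (_ * _)).
  by apply: eq_bigr => i _; rewrite tnthS.
exists (fun s : n.+1.-tuple A => (thead s, [tuple of behead s])).
  by move=> [a s] _ /=; congr (_, _); apply: val_inj.
by move=> s _; rewrite [RHS]tuple_eta.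
Qed.

Lemma seq_expect_le (n : nat) (F G : seq A -> R) :
  (forall s, size s = n -> F s <= G s) -> seq_expect p n F <= seq_expect p n G.
Proof.
elim: n F G => [|n IH] F G FG /=; first exact: FG.
by apply: ler_sum => a _; rewrite ler_wpM2l // IH // => s sn; rewrite FG //= sn.
Qed.

Lemma seq_expectD (n : nat) (F G : seq A -> R) :
  seq_expect p n (fun s => F s + G s) = seq_expect p n F + seq_expect p n G.
Proof.
elim: n F G => [//|n IH] F G /=.
by rewrite -big_split /=; apply: eq_bigr => a _; rewrite IH mulrDr.
Qed.

Lemma seq_expectZ (n : nat) (c : R) (F : seq A -> R) :
  seq_expect p n (fun s => c * F s) = c * seq_expect p n F.
Proof.
elim: n F => [//|n IH] F /=.
by rewrite mulr_sumr; apply: eq_bigr => a _; rewrite IH mulrCA.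
Qed.

Lemma seq_expect_cst (n : nat) (c : R) : seq_expect p n (fun=> c) = c.
Proof. by elim: n => [//|n IH] /=; rewrite IH -mulr_suml p_sum1 mul1r. Qed.

(** Induction on the first letter replaces the usual martingale: given that letter, the induction
    hypothesis treats the rest, and the conditional mean [h] itself varies by at most [w], so
    Hoeffding's lemma applies to it. *)
Lemma bounded_difference_mgf (n : nat) (F : seq A -> R) (w : R) :
  (forall s1 a b s2, (size s1 + size s2).+1 = n ->
     F (s1 ++ a :: s2) - F (s1 ++ b :: s2) <= w) ->
  seq_expect p n (fun s => expR (F s)) <=
    expR (seq_expect p n F + n%:R * (w ^+ 2 / 8)).
Proof.
elim: n F => [|n IH] F Fw /=; first by rewrite mul0r addr0.
pose h a := seq_expect p n (fun s => F (a :: s)).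
apply: (@le_trans _ _ (\sum_a p a * (expR (h a) * expR (n%:R * (w ^+ 2 / 8))))).
  apply: ler_sum => a _; rewrite ler_wpM2l // -expRD IH // => s1 b c s2 sn.
  by have := Fw (a :: s1) b c s2; apply; rewrite /= -sn.
under [leLHS]eq_bigr do rewrite mulrA.
rewrite -mulr_suml -[n.+1%:R]natr1 mulrDl mul1r addrCA addrC expRD.
rewrite ler_wpM2r ?expR_ge0 // hoeffding_lemma // => a b.
rewrite lerBlDr -(seq_expect_cst n w) -seq_expectD.
apply: seq_expect_le => s sn; rewrite -lerBlDr.
by apply: (Fw [::]); rewrite /= sn.
Qed.

Lemma mcdiarmid (n : nat) (F : seq A -> R) (c x : R) :
  0 < c -> (0 < n)%N -> 0 <= x ->
  (forall s1 a b s2, (size s1 + size s2).+1 = n ->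
     F (s1 ++ a :: s2) - F (s1 ++ b :: s2) <= 2 * c) ->
  seq_expect p n (fun s =>
    (seq_expect p n F + c * Num.sqrt (2 * x * n%:R) < F s)%R%:R) <= expR (- x).
Proof.
move=> c0 n0 x0 Fc.
set t := c * _; set m := seq_expect p n F.
have nR : 0 < n%:R :> R by rewrite ltr0n.
(* Chernoff's method: the exponent [n l^2 c^2 / 2 - l t] is smallest at this [l], with value
   [- t^2 / (2 n c^2) = - x]. *)
pose l := t / (n%:R * c ^+ 2).
have t0 : 0 <= t by rewrite mulr_ge0 ?sqrtr_ge0 // ltW.
have l0 : 0 <= l by rewrite divr_ge0 // mulr_ge0 ?sqr_ge0 // ltW.
apply: (@le_trans _ _ (seq_expect p n
    (fun s => expR (- (l * (m + t))) * expR (l * F s)))).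
  apply: seq_expect_le => s _; rewrite -expRD.
  case: ltP => [mF|_]; last exact: expR_ge0.
  rewrite -[leLHS]expR0 ler_expR addrC subr_ge0 ler_wpM2l //; exact: ltW.
rewrite seq_expectZ.
apply: (@le_trans _ _ (expR (- (l * (m + t))) *
    expR (l * m + n%:R * ((l * (2 * c)) ^+ 2 / 8)))).
  rewrite ler_wpM2l ?expR_ge0 // -seq_expectZ.
  apply: (@bounded_difference_mgf n (fun s => l * F s)) => s1 a b s2 sn.
  by rewrite -mulrBr ler_wpM2l // Fc.
rewrite -expRD ler_expR le_eqVlt; apply/orP; left; apply/eqP.
have t2 : t ^+ 2 = c ^+ 2 * (2 * x * n%:R).
  by rewrite exprMn sqr_sqrtr // !mulr_ge0.
have lt : l * t = 2 * x.
  by rewrite /l mulrAC -expr2 t2; field; rewrite !gt_eqF.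
have l2 : n%:R * ((l * (2 * c)) ^+ 2 / 8) = l * t / 2.
  have -> : l * t = l * (l * (n%:R * c ^+ 2)).
    by congr (_ * _); rewrite /l divfK // mulf_neq0 ?expf_neq0 // gt_eqF.
  by field.
by rewrite l2 mulrDr lt; field.
Qed.

End seq_expect_theory.

(** * Symmetrization and contraction *)

(** An operator on functionals [M] of score vectors: it averages [M] over one random shift of its
    argument. With [M] a maximum, iterating it produces the mean supremum of a random sum. *)
Definition shift_avg (R : realType) (J : Type) (A : finType) (q : A -> R)
    (u : A -> J -> R) (M : (J -> R) -> R) (h : J -> R) : R :=
  \sum_a q a * M (fun j => h j + u a j).

Section shift_avg_theory.
Variables (R : realType) (J : Type).
Implicit Types (M : (J -> R) -> R) (h : J -> R).

Lemma shift_avgC (A B : finType) (q : A -> R) (u : A -> J -> R)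
    (q' : B -> R) (u' : B -> J -> R) M :
  shift_avg q u (shift_avg q' u' M) = shift_avg q' u' (shift_avg q u M).
Proof.
apply/funext => h; rewrite /shift_avg.
under eq_bigr do rewrite mulr_sumr.
under [RHS]eq_bigr do rewrite mulr_sumr.
rewrite exchange_big /=; apply: eq_bigr => b _; apply: eq_bigr => a _.
rewrite mulrCA; congr (_ * (_ * M _)).
by apply/funext => j; rewrite addrAC.
Qed.

Lemma shift_avg_iterC (A B : finType) (q : A -> R) (u : A -> J -> R)
    (q' : B -> R) (u' : B -> J -> R) M n :
  shift_avg q u (iter n (shift_avg q' u') M) =
  iter n (shift_avg q' u') (shift_avg q u M).
Proof. by elim: n => [//|n IH] /=; rewrite shift_avgC IH. Qed.

Lemma shift_avg_le (A : finType) (q : A -> R) (u : A -> J -> R) M M' :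
  (forall a, 0 <= q a) -> (forall h, M h <= M' h) ->
  forall h, shift_avg q u M h <= shift_avg q u M' h.
Proof. by move=> q0 MM h; apply: ler_sum => a _; rewrite ler_wpM2l. Qed.

(** A hybrid argument: after [n] shifts have been replaced, the remaining one commutes past them to
    act directly on [M], so a comparison for [M] alone is enough. *)
Lemma iter_shift_avg_le (A B : finType) (q : A -> R) (u : A -> J -> R)
    (q' : B -> R) (u' : B -> J -> R) M n :
  (forall a, 0 <= q a) -> (forall b, 0 <= q' b) ->
  (forall h, shift_avg q u M h <= shift_avg q' u' M h) ->
  forall h, iter n (shift_avg q u) M h <= iter n (shift_avg q' u') M h.
Proof.
move=> q0 q'0 le1; elim: n => [//|n IH] h /=.
apply: le_trans (shift_avg_le _ q0 IH h) _.
rewrite shift_avg_iterC -iterS iterSr.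
by elim: n {IH} h => [//|n IH] h /=; exact: shift_avg_le.
Qed.

Lemma seq_expect_shift (A : finType) (q : A -> R) (u : A -> J -> R) M n h :
  seq_expect q n (fun s => M (fun j => h j + \sum_(a <- s) u a j)) =
  iter n (shift_avg q u) M h.
Proof.
elim: n h => [|n IH] h /=.
  by congr M; apply/funext => j; rewrite big_nil addr0.
apply: eq_bigr => a _; rewrite -IH; congr (_ * seq_expect _ _ _).
apply/funext => s; congr M; apply/funext => j.
by rewrite big_cons addrA.
Qed.

End shift_avg_theory.

(** The index [j0] witnesses that [J] is nonempty. Going through a maximizer gives proofs an index
    where the maximum is attained. *)
Definition fmax (R : realType) (J : finType) (j0 : J) (h : J -> R) : R :=
  h [arg max_(j > j0) h j]%O.

Section fmax_theory.
Variables (R : realType) (J : finType) (j0 : J).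
Implicit Types h : J -> R.

Lemma le_fmax h j : h j <= fmax j0 h.
Proof. by rewrite /fmax; case: arg_maxP => // i _; apply. Qed.

Lemma fmax_le h x : (forall j, h j <= x) -> fmax j0 h <= x.
Proof. by rewrite /fmax; apply. Qed.

(* Talagrand's contraction inequality for a single Rademacher sign. *)
Lemma fmax_contraction h (g v : J -> R) :
  (forall i j, g i - g j <= `|v i - v j|) ->
  fmax j0 (fun j => h j + g j) + fmax j0 (fun j => h j - g j) <=
  fmax j0 (fun j => h j + v j) + fmax j0 (fun j => h j - v j).
Proof.
move=> gv.
rewrite {1}/fmax {1}/fmax.
set i := Order.arg_max _ _ _; set j := Order.arg_max _ _ _.
have := gv i j; have := le_fmax (fun j => h j + v j) i.
have := le_fmax (fun j => h j + v j) j.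
have := le_fmax (fun j => h j - v j) i.
have := le_fmax (fun j => h j - v j) j => /=.
have [v0|v0] := leP 0 (v i - v j).
  by rewrite ger0_norm //; lra.
by rewrite ltr0_norm //; lra.
Qed.

(** An independent copy [b] of the letter represents the mean, and the average over [b] leaves the
    maximum by convexity. Since [h + g_b - g_a] is the midpoint of [h + 2 g_b] and [h - 2 g_a], and
    both letters have law [p], a fair sign in front of [2 g] appears; contraction then trades [g]
    for [v]. The sign is coded by a boolean. *)
Lemma fmax_symmetrization (A : finType) (p : A -> R) (g v : J -> A -> R) h :
  (forall a, 0 <= p a) -> \sum_a p a = 1 ->
  (forall i j a, g i a - g j a <= `|v i a - v j a|) ->
  shift_avg p (fun a j => \sum_b p b * g j b - g j a) (fmax j0) h <=
  shift_avg (fun x : A * bool => p x.1 / 2)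
    (fun x j => (-1) ^+ x.2 * (2 * v j x.1)) (fmax j0) h.
Proof.
move=> p0 p1 gv.
pose X a := fmax j0 (fun j => h j + 2 * g j a).
pose Y a := fmax j0 (fun j => h j - 2 * g j a).
apply: (@le_trans _ _ (\sum_a p a * ((X a + Y a) / 2))).
  apply: (@le_trans _ _ (\sum_a p a * \sum_b p b * ((X b + Y a) / 2))).
    apply: ler_sum => a _; rewrite ler_wpM2l //; apply: fmax_le => j.
    have -> : h j + (\sum_b p b * g j b - g j a) =
              \sum_b p b * (h j - g j a + g j b).
      under [RHS]eq_bigr do rewrite mulrDr.
      by rewrite big_split /= -mulr_suml p1 mul1r; ring.
    apply: ler_sum => b _; rewrite ler_wpM2l //.
    have := le_fmax (fun j => h j + 2 * g j b) j.
    have := le_fmax (fun j => h j - 2 * g j a) j.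
    by rewrite -/(X b) -/(Y a) /=; lra.
  rewrite le_eqVlt; apply/orP; left; apply/eqP.
  transitivity (\sum_a p a * ((\sum_b p b * X b) / 2 + Y a / 2)).
    apply: eq_bigr => a _; congr (_ * _).
    under eq_bigr do rewrite mulrDl mulrDr mulrA.
    by rewrite big_split /= -!mulr_suml p1 mul1r.
  under eq_bigr do rewrite mulrDr.
  rewrite big_split /= -mulr_suml p1 mul1r mulr_suml -big_split /=.
  by apply: eq_bigr => a _; ring.
rewrite /shift_avg.
rewrite -(pair_bigA _ (fun a (e : bool) => p a / 2 *
  fmax j0 (fun j => h j + (-1) ^+ e * (2 * v j a)))) /=.
apply: ler_sum => a _; rewrite big_bool /= expr1 expr0.
rewrite -mulrDr -[p a / 2 * _]mulrA [2^-1 * _]mulrC.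
rewrite ler_wpM2l // ler_wpM2r // [leRHS]addrC.
have -> : (fun j => h j + 1 * (2 * v j a)) = (fun j => h j + 2 * v j a).
  by apply/funext => j; rewrite mul1r.
have -> : (fun j => h j + -1 * (2 * v j a)) = (fun j => h j - 2 * v j a).
  by apply/funext => j; rewrite mulN1r.
apply: fmax_contraction => i j.
by rewrite -!mulrBr normrM (@ger0_norm _ 2) // ler_wpM2l.
Qed.

End fmax_theory.

Lemma sqrtr_midpoint_le (R : realType) (u v : R) : 0 <= u -> 0 <= v ->
  2^-1 * (Num.sqrt u + Num.sqrt v) <= Num.sqrt ((u + v) / 2).
Proof.
move=> u0 v0.
have uv0 : 0 <= (u + v) / 2 by rewrite divr_ge0 ?addr_ge0.
rewrite -ler_sqr ?nnegrE ?mulr_ge0 ?addr_ge0 ?sqrtr_ge0 //.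
rewrite sqr_sqrtr // -{2}(sqr_sqrtr u0) -{2}(sqr_sqrtr v0).
by have := sqr_ge0 (Num.sqrt u - Num.sqrt v); lra.
Qed.

(** * Rademacher averages of linear functionals *)

Definition psd_form (R : realType) (E : lmodType R) (b : E -> E -> R) : Prop :=
  [/\ (forall x y, b x y = b y x), (forall x y z, b (x + y) z = b x z + b y z),
      (forall c x y, b (c *: x) y = c * b x y) & (forall x, 0 <= b x x)].

Section psd_form_theory.
Variables (R : realType) (E : lmodType R) (b : E -> E -> R).
Hypothesis b_form : psd_form b.

Let bC x y : b x y = b y x. Proof. by case: b_form. Qed.
Let bDl x y z : b (x + y) z = b x z + b y z. Proof. by case: b_form. Qed.
Let bZl c x y : b (c *: x) y = c * b x y. Proof. by case: b_form. Qed.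
Let b_ge0 x : 0 <= b x x. Proof. by case: b_form. Qed.
Let bDr x y z : b z (x + y) = b z x + b z y.
Proof. by rewrite bC bDl !(bC _ z). Qed.
Let bZr c x y : b y (c *: x) = c * b y x. Proof. by rewrite bC bZl bC. Qed.

Lemma psd_form_sqrDZ x y c :
  b (x + c *: y) (x + c *: y) = b x x + 2 * c * b x y + c ^+ 2 * b y y.
Proof. by rewrite !(bDl, bDr, bZl, bZr) (bC y x); ring. Qed.

Lemma psd_form_cauchy_schwarz x y : `|b x y| <= Num.sqrt (b x x) * Num.sqrt (b y y).
Proof.
rewrite -sqrtrM // -sqrtr_sqr ler_wsqrtr //.
have [y0|yn0] := eqVneq (b y y) 0.
  have [->|bxy] := eqVneq (b x y) 0; first by rewrite expr0n mulr_ge0.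
  (* On a null vector [y] the form is affine along [x + c y]; this coefficient would give it the
     value -1. *)
  have := b_ge0 (x + (- (b x x + 1) / (2 * b x y)) *: y).
  rewrite psd_form_sqrDZ y0 mulr0 addr0.
  have -> : 2 * (- (b x x + 1) / (2 * b x y)) * b x y = - (b x x + 1) by field.
  by rewrite opprD addrA subrr add0r oppr_ge0 ler10.
have yp : 0 < b y y by rewrite lt0r yn0 b_ge0.
have := b_ge0 (x + (- b x y / b y y) *: y); rewrite psd_form_sqrDZ.
have -> : b x x + 2 * (- b x y / b y y) * b x y + (- b x y / b y y) ^+ 2 * b y y
  = (b x x * b y y - b x y ^+ 2) / b y y by field.
by rewrite pmulr_lge0 ?invr_gt0 // subr_ge0.
Qed.

Lemma psd_form_le x y B r : Num.sqrt (b x x) <= B -> Num.sqrt (b y y) <= r ->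
  `|b x y| <= B * r.
Proof.
move=> xB yr; apply: le_trans (psd_form_cauchy_schwarz x y) _.
by rewrite ler_pM ?sqrtr_ge0.
Qed.

(** Here [y] is the running signed sum. Adding [x a] with either sign changes [b y y] by a cross
    term and at most [r^2]; concavity of the square root averages the opposite cross terms away, and
    Cauchy-Schwarz ends the induction. *)
Lemma rademacher_ball (A : finType) (p : A -> R) (J : finType) (j0 : J)
    (W : J -> E) (x : A -> E) (B r : R) (n : nat) (y : E) :
  (forall a, 0 <= p a) -> \sum_a p a = 1 -> 0 <= r ->
  (forall j, Num.sqrt (b (W j) (W j)) <= B) ->
  (forall a, Num.sqrt (b (x a) (x a)) <= r) ->
  iter n (shift_avg (fun z : A * bool => p z.1 / 2)
    (fun z j => (-1) ^+ z.2 * b (W j) (x z.1))) (fmax j0) (fun j => b (W j) y)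
  <= B * Num.sqrt (b y y + n%:R * r ^+ 2).
Proof.
move=> p0 p1 r0 WB xr.
have B0 : 0 <= B := le_trans (sqrtr_ge0 _) (WB j0).
elim: n y => [|n IH] y /=.
  rewrite mul0r addr0; apply: fmax_le => j.
  by apply: le_trans (ler_norm _) _; exact: psd_form_le.
rewrite /shift_avg.
have xr2 a : b (x a) (x a) <= r ^+ 2.
  by rewrite -(sqr_sqrtr (b_ge0 (x a))) lerXn2r ?nnegrE ?sqrtr_ge0.
have b0 a (e : bool) :
    0 <= b y y + 2 * (-1) ^+ e * b y (x a) + n.+1%:R * r ^+ 2.
  have := b_ge0 (y + (-1) ^+ e *: x a); rewrite psd_form_sqrDZ sqrr_sign mul1r.
  have := xr2 a; have : 0 <= n%:R * r ^+ 2 by rewrite mulr_ge0 ?sqr_ge0.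
  by rewrite -[n.+1%:R]natr1; lra.
apply: (@le_trans _ _ (\sum_(z : A * bool) p z.1 / 2 * 
    (B * Num.sqrt (b y y + 2 * (-1) ^+ z.2 * b y (x z.1) + n.+1%:R * r ^+ 2)))).
  apply: ler_sum => -[a e] _ /=; rewrite ler_wpM2l ?divr_ge0 //.
  have -> : (fun j => b (W j) y + (-1) ^+ e * b (W j) (x a)) =
            (fun j => b (W j) (y + (-1) ^+ e *: x a)).
    by apply/funext => j; rewrite bDr bZr.
  apply: le_trans (IH _) _; rewrite ler_wpM2l // ler_wsqrtr //.
  rewrite psd_form_sqrDZ sqrr_sign mul1r -[n.+1%:R]natr1.
  by have := xr2 a; lra.
rewrite -(pair_bigA _ (fun a (e : bool) => p a / 2 * (B *
    Num.sqrt (b y y + 2 * (-1) ^+ e * b y (x a) + n.+1%:R * r ^+ 2)))) /=.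
set S := Num.sqrt (_ + n.+1%:R * _).
have -> : B * S = \sum_a p a * (B * S) by rewrite -mulr_suml p1 mul1r.
apply: ler_sum => a _; rewrite {}/S.
rewrite big_bool /= expr1 expr0 -mulrDr -mulrDr -[p a / 2 * _]mulrA.
rewrite ler_wpM2l // mulrCA ler_wpM2l //.
have := b0 a false; have := b0 a true; rewrite /= expr1 expr0.
set u := _ + _ + _; set v := _ + _ + _ => u0 v0.
have -> : b y y + n.+1%:R * r ^+ 2 = (u + v) / 2 by rewrite /u /v; field.
exact: sqrtr_midpoint_le.
Qed.

End psd_form_theory.

(** * Uniform deviations over a finite alphabet *)

Section finite_alphabet.
Variables (R : realType) (E : lmodType R) (b : E -> E -> R).
Hypothesis b_form : psd_form b.
Variables (A : finType) (p : A -> R) (J : finType) (j0 : J).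
Hypotheses (p_ge0 : forall a, 0 <= p a) (p_sum1 : \sum_a p a = 1).
Variables (W : J -> E) (x : A -> E) (g : J -> A -> R) (B r rho c : R).
Hypotheses (rho_ge0 : 0 <= rho) (r_ge0 : 0 <= r).
Hypothesis W_le : forall j, Num.sqrt (b (W j) (W j)) <= B.
Hypothesis x_le : forall a, Num.sqrt (b (x a) (x a)) <= r.
Hypothesis g_lip : forall i j a,
  g i a - g j a <= rho * `|b (W i) (x a) - b (W j) (x a)|.
Hypothesis g_le : forall j a, `|g j a| <= c.

Let dev (s : seq A) (j : J) := \sum_(a <- s) (\sum_b p b * g j b - g j a).

(** Symmetrization leaves the signed functionals [2 rho b (W j) (x a)]. Moving [2 rho] into the
    second argument gives a Rademacher average with vectors of seminorm at most [2 rho r], started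
    from the zero vector. *)
Lemma expected_deviation_le (n : nat) :
  seq_expect p n (fun s => fmax j0 (dev s)) <= 2 * rho * B * r * Num.sqrt n%:R.
Proof.
case: b_form => bC bDl bZl b_ge0.
have b0 j : b (W j) 0 = 0 by rewrite bC -(scale0r 0) bZl mul0r.
have -> : seq_expect p n (fun s => fmax j0 (dev s)) =
    iter n (shift_avg p (fun a j => \sum_b p b * g j b - g j a)) (fmax j0)
      (fun j => b (W j) 0).
  rewrite -seq_expect_shift; congr seq_expect; apply/funext => s.
  by congr fmax; apply/funext => j; rewrite b0 add0r.
apply: le_trans (iter_shift_avg_le (q' := fun z : A * bool => p z.1 / 2)
  (u' := fun z j => (-1) ^+ z.2 * (2 * (rho * b (W j) (x z.1)))) _ _ _ _ _) _.
- exact: p_ge0.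
- by move=> z; rewrite /= divr_ge0.
- move=> h; apply: (@fmax_symmetrization _ _ _ _ _ _
    (fun j a => rho * b (W j) (x a))) => // i j a.
  by rewrite -mulrBr normrM (ger0_norm rho_ge0).
have := @rademacher_ball _ _ _ b_form _ p _ j0 W (fun a => (2 * rho) *: x a)
  B (2 * rho * r) n 0 p_ge0 p_sum1.
have -> : (fun z j => (-1) ^+ (z.2 : bool) * (2 * (rho * b (W j) (x z.1)))) =
  (fun (z : A * bool) j => (-1) ^+ z.2 * b (W j) ((2 * rho) *: x z.1)).
  apply/funext => z; apply/funext => j; congr (_ * _).
  by rewrite [RHS]bC bZl [in RHS]bC mulrA.
have r20 : 0 <= 2 * rho * r by rewrite !mulr_ge0.
have -> : b 0 0 = 0 by rewrite -(scale0r 0) bZl mul0r.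
rewrite add0r sqrtrM // sqrtr_sqr ger0_norm // => H.
apply: le_trans (H r20 W_le _) _; last first.
  by rewrite le_eqVlt; apply/orP; left; apply/eqP; ring.
move=> a; rewrite bZl bC bZl mulrA -expr2 sqrtrM ?sqr_ge0 // sqrtr_sqr.
by rewrite ger0_norm ?mulr_ge0 // ler_wpM2l ?mulr_ge0.
Qed.

Lemma uniform_deviation_tail (n : nat) (y : R) : (0 < n)%N -> 0 <= y ->
  seq_expect p n (fun s => [exists j,
     2 * rho * B * r * Num.sqrt n%:R + c * Num.sqrt (2 * y * n%:R) < dev s j]%:R)
  <= expR (- y).
Proof.
move=> n0 y0.
have B0 : 0 <= B := le_trans (sqrtr_ge0 _) (W_le j0).
have a0 := pmf_inhabited p_sum1.
have c0 : 0 <= c := le_trans (normr_ge0 _) (g_le j0 a0).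
(* McDiarmid's bound divides by [c]. For [c = 0] all losses vanish off no set, hence so do the
   deviations, and the strict event is empty. *)
have [c00|cn0] := eqVneq c 0.
  rewrite [leLHS](_ : _ = 0) ?expR_ge0 //.
  rewrite -[RHS](seq_expect_cst p_sum1 n 0).
  congr seq_expect; apply/funext => s; apply/eqP; rewrite pnatr_eq0 eqb0.
  apply/existsPn => j; rewrite -leNgt /dev big1 ?c00.
    by rewrite mul0r addr0 !mulr_ge0 ?sqrtr_ge0.
  have g0 a : g j a = 0 by apply/eqP; rewrite -normr_le0 -c00.
  by move=> a _; rewrite g0 big1 ?subr0 // => d _; rewrite g0 mulr0.
have cp : 0 < c by rewrite lt0r cn0.
apply: le_trans (mcdiarmid p_ge0 p_sum1 (F := fun s => fmax j0 (dev s))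
  cp n0 y0 _).
  apply: seq_expect_le => // s _; rewrite ler_nat.
  case: existsP => [[j devj]|]; last by [].
  rewrite lt0b; apply: le_lt_trans (lt_le_trans devj (le_fmax _ _ _)).
  by rewrite lerD2r expected_deviation_le.
move=> s1 a d s2 _; rewrite lerBlDr; apply: fmax_le => j.
have := le_fmax j0 (dev (s1 ++ d :: s2)) j; rewrite /dev !big_cat !big_cons /=.
have := g_le j a; have := g_le j d; rewrite !ler_norml => /andP[? ?] /andP[? ?].
by lra.
Qed.

End finite_alphabet.

(** * Discretization of a finite class of bounded functions *)

Section discretization.
Context (R : realType) (dT : measure_display) (T : measurableType dT).

Lemma measure_fin_subadditive (P : probability T R) (I : finType)
    (A : I -> set T) (B : set T) :
  (forall i, measurable (A i)) -> measurable B ->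
  (forall t, B t -> exists i, A i t) -> (P B <= \sum_i P (A i))%E.
Proof.
move=> mA mB BA.
have mU (s : seq I) : measurable (\big[setU/set0]_(i <- s) A i).
  exact: bigsetU_measurable.
apply: (@le_trans _ _ (P (\big[setU/set0]_(i : I) A i))).
  apply: le_measure; rewrite ?inE //.
  by move=> t /BA[i Ait]; rewrite (bigD1 i) //=; left.
elim: index_enum => [|i s IH]; first by rewrite !big_nil measure0.
rewrite !big_cons; apply: le_trans (measureU2 _ _ _) _ => //.
exact: leeD2l.
Qed.

Lemma exists_off_null (D : probability T R) (M : set T) :
  D M = 0%E -> exists t, ~ M t.
Proof.
move=> M_null; apply: contrapT => /forallNP allM.
have MT : M = setT by apply/seteqP; split=> // t _; exact: contrapT.
by move: M_null; rewrite MT probability_setT => /eqP; rewrite eqe oner_eq0.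
Qed.

(** The code [k t] records, for each [j], which multiples of [e] lie below [g j t + c]. Off [M] this
    number is in [[0, 2 c]], so finitely many levels suffice. *)
Lemma finite_quantizer (J : finType) (g : J -> T -> R) (c e : R) (M : set T) :
  (forall j, measurable_fun setT (g j)) -> 0 < e ->
  (forall j t, ~ M t -> `|g j t| <= c) ->
  exists (A : finType) (k : T -> A),
    (forall a, measurable (k @^-1` [set a])) /\
    (forall j t u, ~ M t -> ~ M u -> k t = k u -> g j t <= g j u + e).
Proof.
move=> mg e0 gc; pose L := Num.trunc (2 * c / e).
pose k t := [ffun x : J * 'I_L.+1 => x.2%:R * e <= g x.1 t + c].
exists {ffun J * 'I_L.+1 -> bool}, k; split=> [a|j t u Mt Mu ktu].
  have -> : k @^-1` [set a] = \bigcap_(x in [set: J * 'I_L.+1])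
      (g x.1 @^-1` [set y | (x.2%:R * e <= y + c) = a x]).
    apply/seteqP; split=> [t <- x _|t ta] /=; first by rewrite ffunE.
    by apply/ffunP => x; rewrite ffunE; exact: ta.
  apply: fin_bigcap_measurable; first exact: finite_finset.
  move=> x _; rewrite -[X in measurable X]setTI; apply: mg => //.
  have -> : [set y | (x.2%:R * e <= y + c) = a x] =
      (if a x then `[x.2%:R * e - c, +oo[%classic else `]-oo, x.2%:R * e - c[%classic).
    apply/seteqP; split=> y /=; case: (a x); rewrite /= in_itv /= ?andbT.
    - by rewrite lerBlDr.
    - by move/negbT; rewrite -ltNge ltrBrDr.
    - by rewrite lerBlDr.
    - by rewrite ltrBrDr => h; apply/negbTE; rewrite -ltNge.
  by case: (a x); exact: measurable_itv.
rewrite leNgt; apply/negP => lt_e.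
have ut0 : 0 <= (g j u + c) / e.
  by rewrite divr_ge0 ?(ltW e0) //; move: (gc j u Mu); rewrite ler_norml; lra.
(* The first level above [g j u + c]. A gap larger than [e] would place it below [g j t + c], so the
   codes of [t] and [u] would differ. *)
pose l := (Num.trunc ((g j u + c) / e)).+1.
have /andP[l1 l2] := truncn_itv ut0; rewrite -/l in l2.
have le_t : l%:R * e <= g j t + c.
  move: l1; rewrite ler_pdivlMr // => l1.
  by rewrite /l -natr1 mulrDl mul1r; lra.
have ltu : g j u + c < l%:R * e by rewrite -ltr_pdivrMr.
have lL : (l < L.+1)%N.
  have c0 : 0 <= c := le_trans (normr_ge0 _) (gc j t Mt).
  rewrite ltnS truncn_ge_nat ?divr_ge0 ?mulr_ge0 ?(ltW e0) // ler_pdivlMr //.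
  by move: (gc j t Mt); rewrite ler_norml; lra.
have := congr1 (fun f : {ffun _ -> bool} => f (j, Ordinal lL)) ktu.
by rewrite !ffunE /= le_t leNgt ltu.
Qed.

Lemma integral_finite_range (D : probability T R) (A : finType) (k : T -> A)
    (h : A -> R) :
  (forall a, measurable (k @^-1` [set a])) ->
  D.-integrable setT (fun t => (h (k t))%:E) /\
  (\int[D]_t (h (k t))%:E =
   (\sum_a fine (D (k @^-1` [set a])) * h a)%:E)%E.
Proof.
move=> mk.
have hE t : (h (k t))%:E =
    (\sum_a (h a)%:E * (\1_(k @^-1` [set a]) t)%:E)%E.
  rewrite (bigD1 (k t)) //= big1 ?adde0.
    by rewrite indicE mem_set // mule1.
  move=> a akt; rewrite indicE memNset ?mule0 //.
  by move=> /= kta; rewrite kta eqxx in akt.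
have ind a : D.-integrable setT
    (fun t => ((h a)%:E * (\1_(k @^-1` [set a]) t)%:E)%E).
  by apply: integrableZl => //; exact: integrable_indic.
split.
  under eq_fun do rewrite hE.
  exact: integrable_sum.
under eq_integral do rewrite hE.
rewrite integral_sum // -sumEFin; apply: eq_bigr => a _.
rewrite integralZl //; last exact: integrable_indic.
rewrite integral_indic // setIT EFinM fineK ?fin_num_measure //.
by rewrite muleC.
Qed.

Lemma integral_le_off_null (D : probability T R) (M : set T) (f g : T -> R) :
  measurable M -> D M = 0%E ->
  D.-integrable setT (EFin \o f) -> D.-integrable setT (EFin \o g) ->
  (forall t, ~ M t -> f t <= g t) ->
  (\int[D]_t (f t)%:E <= \int[D]_t (g t)%:E)%E.
Proof.
move=> mM M0 intf intg fg.
have mTM : measurable (setT `\` M) by exact: measurableD.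
rewrite (negligible_integral mM _ intf M0) //.
rewrite (negligible_integral mM _ intg M0) //.
apply: le_integral => //; [exact: integrableS intf|exact: integrableS intg|].
by move=> t; rewrite inE => -[_ /fg]; rewrite lee_fin.
Qed.

Lemma integrable_bounded_off_null (D : probability T R) (M : set T)
    (f : T -> R) (c : R) :
  measurable M -> D M = 0%E -> measurable_fun setT f ->
  (forall t, ~ M t -> `|f t| <= c) -> D.-integrable setT (EFin \o f).
Proof.
move=> mM M0 mf fc.
have mTM : measurable (setT `\` M) by exact: measurableD.
apply/integrableP; split; first exact/measurable_EFinP.
rewrite (ge0_negligible_integral mM) //; last first.
  by apply: measurableT_comp => //; exact/measurable_EFinP.
apply: (@le_lt_trans _ _ (\int[D]_(t in setT `\` M) c%:E)%E).
  apply: ge0_le_integral => //.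
  - apply: measurableT_comp => //; apply/measurable_EFinP.
    exact: measurable_funS mf.
  - by move=> t [_ Mt]; rewrite lee_fin; exact: fc.
rewrite integral_cst // ltey_eq fin_numM //; exact: fin_num_measure.
Qed.

End discretization.

(** * Uniform deviations of a finite class under a general law *)

Section finite_class.
Context (R : realType) (d dT : measure_display).
Context (Omega : measurableType d) (T : measurableType dT).
Context (P : probability Omega R) (D : probability T R).
Context (N : nat) (Z : 'I_N -> Omega -> T) (M : set T).
Hypotheses (N_gt0 : (0 < N)%N) (Z_iid : iid_sample P D Z).
Hypotheses (mM : measurable M) (M_null : D M = 0%E).
Context (E : lmodType R) (b : E -> E -> R) (xi : T -> E).
Hypothesis b_form : psd_form b.
Context (J : finType) (j0 : J) (W : J -> E) (g : J -> T -> R) (B r rho c : R).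
Hypotheses (rho_ge0 : 0 <= rho) (r_ge0 : 0 <= r).
Hypothesis W_le : forall j, Num.sqrt (b (W j) (W j)) <= B.
Hypothesis xi_le : forall t, ~ M t -> Num.sqrt (b (xi t) (xi t)) <= r.
Hypothesis mg : forall j, measurable_fun setT (g j).
Hypothesis g_le : forall j t, ~ M t -> `|g j t| <= c.
Hypothesis g_lip : forall i j t,
  g i t - g j t <= rho * `|b (W i) (xi t) - b (W j) (xi t)|.

Let mean j := fine (\int[D]_t (g j t)%:E)%E.
Let deviation omega j := \sum_(i < N) (mean j - g j (Z i omega)).

Lemma measurable_deviation j : measurable_fun setT (deviation^~ j).
Proof.
case: Z_iid => mZ _ _.
apply: measurable_sum => i; apply: measurable_funB; first exact: measurable_cst.
exact: measurableT_comp (mg j) (mZ i).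
Qed.

Lemma measurable_deviation_gt x :
  measurable [set omega | exists j, x < deviation omega j].
Proof.
have -> : [set omega | exists j, x < deviation omega j] =
    \bigcup_(j in [set: J]) (deviation^~ j @^-1` `]x, +oo[).
  apply/seteqP; split=> [omega [j xj]|omega [j _ /= xj]]; exists j => //=.
    by rewrite in_itv /= andbT.
  by move: xj; rewrite in_itv /= andbT.
apply: fin_bigcup_measurable; first exact: finite_finset.
move=> j _; rewrite -[X in measurable X]setTI.
exact: measurable_deviation.
Qed.

(* Replacing T by the finitely many cells of a quantizer with representatives
   outside M turns all expectations into finite sums, at the cost of e per
   evaluation. *)
Lemma finite_class_tail (e y : R) : 0 < e -> 0 <= y ->
  (P [set omega | exists j, ((2 * rho * B * r * Num.sqrt N%:R +
        c * Num.sqrt (2 * y * N%:R)) + N%:R * (2 * e) < deviation omega j)%R]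
   <= (expR (- y))%:E)%E.
Proof.
move=> e0 y0; case: (Z_iid) => mZ lawZ indZ.
have [A [k [mk kg]]] := finite_quantizer mg e0 g_le.
have [t0 Mt0] := exists_off_null M_null.
(* A cell lying inside [M] has no representative of its own; it receives [t0], and the implication
   is vacuous there. *)
have /choice[rep repP] : forall a, exists t, ~ M t /\
    (forall u, ~ M u -> k u = a -> k t = a).
  move=> a.
  have [[t [Mt kta]]|h] := pselect (exists t, ~ M t /\ k t = a).
    by exists t.
  by exists t0; split=> // t Mt kta; exfalso; apply: h; exists t.
have repM a : ~ M (rep a) by case: (repP a).
have repk t : ~ M t -> k (rep (k t)) = k t.
  by move=> Mt; case: (repP (k t)) => _ /(_ t Mt erefl).
pose p a := fine (D (k @^-1` [set a])).
have p_ge0 a : 0 <= p a by rewrite fine_ge0.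
have p_sum1 : \sum_a p a = 1.
  have [_] := integral_finite_range D (fun=> 1) mk.
  rewrite integral_cst // mul1e => h.
  have [->] := etrans (esym (probability_setT D)) h.
  by apply: eq_bigr => a _; rewrite mulr1.
pose G j a := g j (rep a).
have intg j : D.-integrable setT (EFin \o g j).
  exact: integrable_bounded_off_null mM M_null (mg j) (@g_le j).
have mean_le j : mean j <= \sum_a p a * G j a + e.
  have [intG intGE] := integral_finite_range D (fun a => G j a + e) mk.
  have -> : \sum_a p a * G j a + e = \sum_a p a * (G j a + e).
    under [RHS]eq_bigr do rewrite mulrDr.
    by rewrite big_split /= -mulr_suml p_sum1 mul1r.
  rewrite -lee_fin -intGE fineK; last exact: integrable_fin_num (intg j).
  apply: (integral_le_off_null mM M_null) => // t Mt.
  by apply: kg => //; rewrite repk.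
pose dev (s : seq A) j := \sum_(a <- s) (\sum_b p b * G j b - G j a).
set x := 2 * rho * B * r * Num.sqrt N%:R + _.
pose bad (s : N.-tuple A) := [exists j, x < dev s j].
(* Each of the [N] summands costs [e] for the mean and [e] for the observation. *)
have dev_le omega j : (forall i, ~ M (Z i omega)) ->
    deviation omega j <=
    dev [tuple k (Z i omega) | i < N] j + N%:R * (2 * e).
  move=> MZ; rewrite /dev big_tuple -[N in N%:R]card_ord mulr_natl -sumr_const.
  rewrite -big_split /=; apply: ler_sum => i _; rewrite tnth_mktuple.
  have := mean_le j.
  have := kg j (rep (k (Z i omega))) (Z i omega) (repM _) (MZ i) (repk _ (MZ i)).
  by rewrite /G; lra.
pose cell (s : N.-tuple A) : set Omega :=
  \bigcap_(i in [set: 'I_N]) (Z i @^-1` (k @^-1` [set tnth s i])).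
have mcell s : measurable (cell s).
  apply: fin_bigcap_measurable; first exact: finite_finset.
  by move=> i _; rewrite -[X in measurable X]setTI; exact: mZ.
have Pcell s : P (cell s) = (\prod_(i < N) p (tnth s i))%:E.
  rewrite indZ // -prodEFin; apply: eq_bigr => i _.
  by rewrite lawZ // fineK // fin_num_measure.
have mZM i : measurable (Z i @^-1` M).
  by rewrite -[X in measurable X]setTI; exact: mZ.
(* A finite cover of the bad event: either some observation falls in the null set, or the sample
   lies in the product cell of a bad word. By independence, the cell probabilities are the weights
   of [seq_expect_tuple]. *)
pose C (z : 'I_N + N.-tuple A) : set Omega :=
  match z with inl i => Z i @^-1` M | inr s => if bad s then cell s else set0 end.
apply: (@le_trans _ _ (\sum_z P (C z))%E).
  apply: measure_fin_subadditive.
  - by move=> [i|s] //=; case: ifP.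
  - exact: measurable_deviation_gt.
  move=> omega [j xj].
  have [MZ|/existsNP[i /contrapT Mi]] := pselect (forall i, ~ M (Z i omega)).
    exists (inr [tuple k (Z i omega) | i < N]) => /=.
    have -> : bad [tuple k (Z i omega) | i < N].
      apply/existsP; exists j; rewrite -(ltrD2r (N%:R * (2 * e))).
      exact: lt_le_trans xj (dev_le omega j MZ).
    by move=> i _; rewrite /= tnth_mktuple.
  by exists (inl i).
rewrite big_sumType /= big1 ?add0e; last by move=> i _; rewrite lawZ.
have := uniform_deviation_tail b_form j0 p_ge0 p_sum1 rho_ge0 r_ge0 W_le
  (fun a => xi_le (repM a)) (fun i j a => g_lip i j (rep a))
  (fun j a => g_le j (repM a)) N_gt0 y0.
rewrite seq_expect_tuple -lee_fin; apply: le_trans.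
rewrite -sumEFin; apply: lee_sum => s _.
rewrite -/(bad s); case: (bad s); rewrite ?mul1r ?mul0r ?measure0 //.
by rewrite Pcell.
Qed.

End finite_class.

(** * Uniform deviations over a separable ball *)

Section separable_ball.
Context (R : realType) (d dT : measure_display).
Context (Omega : measurableType d) (T : measurableType dT).
Context (P : probability Omega R) (D : probability T R).
Context (N : nat) (Z : 'I_N -> Omega -> T) (M : set T).
Hypotheses (N_gt0 : (0 < N)%N) (Z_iid : iid_sample P D Z).
Hypotheses (mM : measurable M) (M_null : D M = 0%E).
Context (E : lmodType R) (b : E -> E -> R) (xi : T -> E).
Hypothesis b_form : psd_form b.
Context (g : E -> T -> R) (B r rho c : R).
Hypotheses (rho_ge0 : 0 <= rho) (r_ge0 : 0 <= r).
Let ball := [set W | Num.sqrt (b W W) <= B].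
Hypothesis xi_le : forall t, ~ M t -> Num.sqrt (b (xi t) (xi t)) <= r.
Hypothesis mg : forall W, ball W -> measurable_fun setT (g W).
Hypothesis g_le : forall W t, ball W -> ~ M t -> `|g W t| <= c.
Hypothesis g_lip : forall W W' t,
  `|g W t - g W' t| <= rho * `|b W (xi t) - b W' (xi t)|.
Context (w : nat -> E).
Hypothesis w_ball : forall i, ball (w i).
Hypothesis w_dense : forall W e, ball W -> 0 < e ->
  exists i, Num.sqrt (b (W - w i) (W - w i)) <= e.

Let mean W := fine (\int[D]_t (g W t)%:E)%E.
Let deviation omega W := \sum_(i < N) (mean W - g W (Z i omega)).

Let intg W : ball W -> D.-integrable setT (EFin \o g W).
Proof.
move=> bW.
exact: integrable_bounded_off_null mM M_null (mg bW) (fun t => g_le bW).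
Qed.

Lemma mean_le_off_null W W' e : ball W -> ball W' ->
  (forall t, ~ M t -> g W t <= g W' t + e) -> mean W <= mean W' + e.
Proof.
move=> bW bW' gWW'.
have inte : D.-integrable setT (EFin \o cst e).
  exact: finite_measure_integrable_cst.
have intD : D.-integrable setT (EFin \o (fun t => g W' t + e)).
  by have := integrableD measurableT (intg bW') inte.
rewrite -lee_fin fineK; last exact: integrable_fin_num (intg bW).
apply: le_trans (integral_le_off_null mM M_null (intg bW) intD gWW') _.
have -> : (\int[D]_t (g W' t + e)%:E =
    \int[D]_t ((EFin \o g W') t + (EFin \o cst e) t))%E by [].
rewrite (integralD measurableT (intg bW') inte) EFinD fineK; last first.
  exact: integrable_fin_num (intg bW').
rewrite leeD2l // -[leRHS]mule1 -(probability_setT D).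
by rewrite (integral_cst D measurableT e%:E).
Qed.

(** An explicit measurable event is built from countably many predictors, so measurability of the
    supremum over the ball never arises. Lipschitz continuity carries the bound from the dense
    sequence to the whole ball. *)
Lemma uniform_deviation_ball (y : R) : 0 <= y ->
  exists G : set Omega, [/\ measurable G, ((1 - expR (- y))%:E <= P G)%E &
    forall omega W, G omega -> ball W ->
      deviation omega W <=
      2 * rho * B * r * Num.sqrt N%:R + c * Num.sqrt (2 * y * N%:R)].
Proof.
move=> y0; case: (Z_iid) => mZ lawZ _.
set beta := 2 * rho * B * r * _ + _.
(* As [k] grows the class gains a predictor and the slack shrinks to 0. The events therefore
   increase, and their union inherits the common bound [expR (- y)]. *)
pose bad k := [set omega | exists j : 'I_k.+1,
  beta + N%:R * (2 * k.+1%:R^-1) < deviation omega (w j)].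
have mbad k : measurable (bad k).
  exact: (measurable_deviation_gt Z_iid (fun j : 'I_k.+1 => mg (w_ball j))).
have Pbad k : (P (bad k) <= (expR (- y))%:E)%E.
  have lip (i j : 'I_k.+1) t :
      g (w i) t - g (w j) t <= rho * `|b (w i) (xi t) - b (w j) (xi t)|.
    exact: le_trans (ler_norm _) (g_lip _ _ _).
  have e0 : 0 < k.+1%:R^-1 :> R by rewrite invr_gt0.
  exact: (finite_class_tail N_gt0 Z_iid mM M_null b_form ord0 rho_ge0 r_ge0
    (fun j : 'I_k.+1 => w_ball j) xi_le (fun j : 'I_k.+1 => mg (w_ball j))
    (fun j t => g_le (w_ball j)) lip e0 y0).
have bad_nd : nondecreasing_seq bad.
  apply/nondecreasing_seqP => k; apply/subsetPset => omega [j devj].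
  exists (widen_ord (leqnSn _) j); apply: le_lt_trans devj => /=.
  by rewrite lerD2l ler_wpM2l // ler_wpM2l // lef_pV2 ?posrE // ler_nat.
have mbadU : measurable (\bigcup_k bad k) by exact: bigcup_measurable.
have PbadU : (P (\bigcup_k bad k) <= (expR (- y))%:E)%E.
  have cv := @nondecreasing_cvg_mu _ _ _ P bad mbad mbadU bad_nd.
  rewrite -(cvg_lim _ cv) //; apply: lime_le; first by apply/cvg_ex; eexists; exact: cv.
  by apply: nearW => k; exact: Pbad.
have mZM i : measurable (Z i @^-1` M).
  by rewrite -[X in measurable X]setTI; exact: mZ.
pose null := \bigcup_(i in [set: 'I_N]) (Z i @^-1` M).
have mnull : measurable null.
  by apply: fin_bigcup_measurable => //; exact: finite_finset.
have Pnull : P null = 0%E.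
  apply/eqP; rewrite -measure_le0.
  apply: (@le_trans _ _ (\sum_(i < N) P (Z i @^-1` M))%E).
    by apply: measure_fin_subadditive => // omega [i _ Mi]; exists i.
  by rewrite big1 // => i _; rewrite lawZ.
exists (~` (null `|` \bigcup_k bad k)).
have mU : measurable (null `|` \bigcup_k bad k) by exact: measurableU.
split; first exact: measurableC.
  rewrite probability_setC // EFinB leeB //.
  apply: le_trans (measureU2 _ mnull mbadU) _.
  have Pnull0 : (P null <= 0)%E by rewrite Pnull.
  by apply: le_trans (leeD Pnull0 PbadU) _; rewrite add0e.
move=> omega W Gomega bW.
have MZ i : ~ M (Z i omega) by move=> Mi; apply: Gomega; left; exists i.
have devw j : deviation omega (w j) <= beta.
  rewrite leNgt; apply/negP => lt_dev; apply: Gomega; right.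
  pose gap := deviation omega (w j) - beta.
  have gap0 : 0 < gap by rewrite subr_gt0.
  (* Large enough that [w j] belongs to the class and the slack [2 N / (k + 1)] is below [gap]. *)
  pose k := maxn j (Num.trunc (gap^-1 * (2 * N%:R))).
  exists k => //; exists (inord j) => /=.
  have jk : (j < k.+1)%N by rewrite ltnS leq_maxl.
  rewrite inordK // -ltrBrDl -/gap mulrA ltr_pdivrMr // mulrC.
  rewrite -ltr_pdivrMl // mulrC [N%:R * 2]mulrC.
  apply: lt_le_trans (truncnS_gt _) _.
  by rewrite ler_nat ltnS leq_maxr.
apply/ler_addgt0Pr => e e0.
(* Approximating [W] within [e / K] changes the summed deviation by less than [e]; the added 1 keeps
   [K] positive when [rho * r = 0]. *)
pose K := 2 * N%:R * rho * r + 1.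
have NR : 0 < N%:R :> R by rewrite ltr0n.
have K0 : 0 < K by rewrite ltr_wpDl // !mulr_ge0.
have [j wj] := w_dense bW (divr_gt0 e0 K0).
pose s := rho * (e / K * r).
have gW t : ~ M t -> `|g W t - g (w j) t| <= s.
  move=> Mt; apply: le_trans (g_lip _ _ _) _; rewrite ler_wpM2l //.
  case: (b_form) => bC bDl bZl _.
  have -> : b W (xi t) - b (w j) (xi t) = b (W - w j) (xi t).
    by rewrite bDl -scaleN1r bZl mulN1r.
  exact: psd_form_le (xi_le Mt).
have gW1 t : ~ M t -> g W t <= g (w j) t + s.
  by move=> /gW; rewrite ler_norml; lra.
have meanW := mean_le_off_null bW (w_ball j) gW1.
apply: (@le_trans _ _ (deviation omega (w j) + N%:R * (2 * s))).
  rewrite /deviation -[N in N%:R]card_ord mulr_natl -sumr_const -big_split /=.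
  apply: ler_sum => i _; have := gW _ (MZ i); rewrite ler_norml; move: meanW.
  by lra.
rewrite lerD //.
have -> : N%:R * (2 * s) = e * ((2 * N%:R * rho * r) / K).
  by rewrite /s; ring.
by rewrite -[leRHS]mulr1 ler_wpM2l ?(ltW e0) // ler_pdivrMr // mul1r lerDl.
Qed.

End separable_ball.

(** * The V-weighted form on matrices *)

(** The set [S] may contain no rational matrix. For each rational matrix and each precision, a point
    of [S] that close to it is chosen if one exists, and [W0] otherwise; these countably many
    choices are dense in [S]. *)
Lemma matrix_subset_separable (R : realType) (m n : nat)
    (S : set 'M[R]_(m, n)) (W0 : 'M[R]_(m, n)) : S W0 ->
  exists w : nat -> 'M[R]_(m, n), (forall i, S (w i)) /\
    forall W e, S W -> 0 < e -> exists i, forall k l, `|(W - w i) k l| <= e.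
Proof.
move=> SW0.
pose near_pt (q : 'M[rat]_(m, n)) (h : nat) (W : 'M[R]_(m, n)) :=
  forall k l, `|W k l - ratr (q k l)| <= h.+1%:R^-1.
have /choice[f fP] : forall x : 'M[rat]_(m, n) * nat, exists W, S W /\
    ((exists W', S W' /\ near_pt x.1 x.2 W') -> near_pt x.1 x.2 W).
  move=> x; have [[W [SW nW]]|h] := pselect (exists W, S W /\ near_pt x.1 x.2 W).
    by exists W.
  by exists W0; split=> // /h.
exists (fun i => oapp f W0 (unpickle i)); split.
  by move=> i; case: unpickle => [x|] //=; case: (fP x).
move=> W e SW e0.
(* The target and the chosen point are both within [1 / (h + 1)] of the same rational matrix, hence
   the factor 2. *)
pose h := Num.trunc (2 / e).
have he : 2 * h.+1%:R^-1 <= e.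
  rewrite ler_pdivrMr // mulrC -ler_pdivrMr //.
  exact: ltW (truncnS_gt _).
have h0 : 0 < h.+1%:R^-1 :> R by rewrite invr_gt0.
have /choice[q qP] : forall x : 'I_m * 'I_n, exists q : rat,
    `|W x.1 x.2 - ratr q| <= h.+1%:R^-1.
  move=> x; have [] := @rat_in_itvoo R (W x.1 x.2 - h.+1%:R^-1) (W x.1 x.2 + h.+1%:R^-1).
    by rewrite ltrBlDr -addrA ltrDl addr_gt0.
  move=> q; rewrite in_itv /= => /andP[q1 q2]; exists q.
  rewrite ler_norml; apply/andP; split.
    by rewrite lerNl opprB lerBlDl ltW.
  by rewrite lerBlDl -lerBlDr ltW.
pose Q := \matrix_(k, l) q (k, l).
have nW : near_pt Q h W by move=> k l; rewrite mxE; exact: qP (k, l).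
exists (pickle (Q, h)); rewrite pickleK /= => k l.
have [_ /(_ (ex_intro _ W (conj SW nW))) nf] := fP (Q, h).
rewrite !mxE; have := nf k l; have := nW k l.
rewrite /= !ler_norml; move: he; move: (h.+1%:R^-1) => a.
by rewrite !mxE; lra.
Qed.

Section weighted_form.
Variables (R : realType) (m n : nat) (V : 'M[R]_n).

(** The square root of [V_form A A] is [H_norm V A] by conversion, so bounds on either serve for the
    other. *)
Definition V_form (A B : 'M[R]_(m, n)) : R :=
  frob_inner (H_inner A B) (Vnormalized V).

Lemma V_form_psd : V^T = V -> (forall A, 0 <= V_form A A) -> psd_form V_form.
Proof.
move=> VT V_ge0; rewrite /V_form /frob_inner /H_inner; split=> //.
- move=> A B; rewrite exchange_big /=; apply: eq_bigr => i _.
  apply: eq_bigr => j _; congr (_ * _).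
    by rewrite !mxE; apply: eq_bigr => k _; rewrite !mxE mulrC.
  by rewrite /Vnormalized !mxE; congr (_ * _); rewrite -{1}VT mxE.
- move=> A B C; rewrite -big_split /=; apply: eq_bigr => i _.
  rewrite -big_split /=; apply: eq_bigr => j _.
  by rewrite linearD /= mulmxDl mxE mulrDl.
- move=> c A B; rewrite mulr_sumr; apply: eq_bigr => i _.
  rewrite mulr_sumr; apply: eq_bigr => j _.
  by rewrite linearZ /= -scalemxAl mxE mulrA.
Qed.

(** Turns entrywise density into density for the seminorm: entries bounded by [h] give
    [V_form A A <= h^2 C]. The 1 added to the root of [C] covers [C = 0]. *)
Lemma V_form_small (e : R) : 0 < e -> exists2 h, 0 < h &
  forall A : 'M[R]_(m, n), (forall k l, `|A k l| <= h) -> Num.sqrt (V_form A A) <= e.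
Proof.
move=> e0.
pose C := \sum_(i < n) \sum_(j < n) m%:R * `|Vnormalized V i j|.
have C0 : 0 <= C.
  by apply: sumr_ge0 => i _; apply: sumr_ge0 => j _; rewrite mulr_ge0.
have K0 : 0 < Num.sqrt C + 1 by rewrite ltr_wpDl ?sqrtr_ge0.
pose h := e / (Num.sqrt C + 1).
have h0 : 0 < h by rewrite divr_gt0.
exists h => // A Ah.
have : V_form A A <= h ^+ 2 * C.
  rewrite /V_form /frob_inner /H_inner mulr_sumr; apply: ler_sum => i _.
  rewrite mulr_sumr; apply: ler_sum => j _.
  apply: le_trans (ler_norm _) _; rewrite normrM mulrA ler_wpM2r //.
  rewrite !mxE; apply: le_trans (ler_norm_sum _ _ _) _.
  rewrite mulrC -[m in m%:R]card_ord mulr_natl -sumr_const.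
  apply: ler_sum => k _; rewrite !mxE normrM expr2.
  by rewrite ler_pM.
move=> /ler_wsqrtr/le_trans; apply.
rewrite sqrtrM ?sqr_ge0 // sqrtr_sqr ger0_norm ?(ltW h0) //.
rewrite /h mulrAC ler_pdivrMr // ler_wpM2l ?(ltW e0) //.
by rewrite lerDl.
Qed.

End weighted_form.

Theorem theorem2 (R : realType) (m n : nat) (V : 'M[R]_n)
  (d dT : measure_display) (Omega : measurableType d) (T : measurableType dT)
  (Y : Type) (X : T -> 'M[R]_(m, n)) (lab : T -> Y)
  (D : probability T R) (P : probability Omega R)
  (R' B' rho c' : R) (Phi : R -> Y -> R) (N : nat) (Z : 'I_N -> Omega -> T)
  (delta : R) :
  (0 < m)%N -> (0 < n)%N ->
  V != 0 -> V^T = V ->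
  (forall A : 'M[R]_(m, n), 0 <= frob_inner (H_inner A A) (Vnormalized V)) ->
  {ae D, forall t, H_norm V (X t) <= R'} ->
  (forall y : Y, forall a b : R, `|Phi a y - Phi b y| <= rho * `|a - b|) ->
  (forall y : Y, forall a : R, - (B' * R') <= a <= B' * R' -> `|Phi a y| <= c') ->
  (forall W : 'M[R]_(m, n), H_norm V W <= B' ->
     measurable_fun setT
       (fun t => Phi (frob_inner (H_inner W (X t)) (Vnormalized V)) (lab t))) ->
  (0 < N)%N ->
  iid_sample P D Z ->
  0 < delta < 1 ->
  exists E : set Omega,
    [/\ measurable E, ((1 - delta)%:E <= P E)%E &
      forall omega, E omega ->
      forall W : 'M[R]_(m, n), H_norm V W <= B' ->
        (\int[D]_t (Phi (frob_inner (H_inner W (X t)) (Vnormalized V)) (lab t))%:E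
         <= ((N%:R)^-1 * \sum_(i < N)
                Phi (frob_inner (H_inner W (X (Z i omega))) (Vnormalized V))
                    (lab (Z i omega))
             + 2 * rho * B' * R' / Num.sqrt (N%:R)
             + c' * Num.sqrt (2 * ln (2 / delta) / N%:R))%:E)%E].
Proof.
move=> _ _ _ VT V_ge0 [M [mM M_null XM]] Phi_lip Phi_le mPhi N_gt0 Z_iid.
move=> /andP[delta_gt0 delta_lt1].
have b_form : psd_form (V_form V) := V_form_psd VT V_ge0.
(* For negative [B'] the ball is empty, so the whole space serves as the event. *)
have [B_ge0|B_lt0] := leP 0 B'; last first.
  exists setT; split=> //; first by rewrite probability_setT lee_fin gerBl ltW.
  move=> omega _ W; rewrite /H_norm => WB.
  by have := lt_le_trans B_lt0 (le_trans (sqrtr_ge0 _) WB); rewrite ltxx.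
have X_le t : ~ M t -> Num.sqrt (V_form V (X t) (X t)) <= R'.
  by move=> Mt; apply: contrapT => Xt; apply: Mt; exact: XM.
have [t0 Mt0] := exists_off_null M_null.
have R_ge0 : 0 <= R' := le_trans (sqrtr_ge0 _) (X_le t0 Mt0).
have rho_ge0 : 0 <= rho.
  have := Phi_lip (lab t0) 1 0; rewrite subr0 normr1 mulr1.
  exact: le_trans (normr_ge0 _).
pose g W t := Phi (V_form V W (X t)) (lab t).
have g_le W t : Num.sqrt (V_form V W W) <= B' -> ~ M t -> `|g W t| <= c'.
  move=> WB Mt; apply: Phi_le; rewrite -ler_norml.
  exact: psd_form_le (X_le t Mt).
have V0 : Num.sqrt (V_form V (0 : 'M[R]_(m, n)) 0) <= B'.
  by case: b_form => _ _ bZl _; rewrite -(scale0r 0) bZl mul0r sqrtr0.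
have [w [w_ball w_near]] := matrix_subset_separable
  (S := [set W | Num.sqrt (V_form V W W) <= B']) V0.
have w_dense (W : 'M[R]_(m, n)) e : Num.sqrt (V_form V W W) <= B' -> 0 < e ->
    exists i, Num.sqrt (V_form V (W - w i) (W - w i)) <= e.
  move=> WB /(V_form_small m V)[h h_gt0 hP].
  by have [i wi] := w_near W h WB h_gt0; exists i; exact: hP.
have y_ge0 : 0 <= ln (2 / delta).
  by rewrite ln_ge0 // ler_pdivlMr // mul1r (le_trans (ltW delta_lt1)) // ler1n.
have [G [mG PG devG]] := uniform_deviation_ball N_gt0 Z_iid mM M_null b_form
  rho_ge0 R_ge0 X_le mPhi g_le (fun W W' t => Phi_lip (lab t) _ _)
  w_ball w_dense y_ge0.
exists G; split=> //.
  (* With [y = ln (2 / delta)] the failure probability [expR (- y)] is [delta / 2], at most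
     [delta]. *)
  apply: le_trans PG; rewrite lee_fin lerD2l lerN2.
  rewrite expRN lnK ?posrE ?divr_gt0 // invf_div ler_pdivrMr //.
  by rewrite ler_peMr ?ler1n // ltW.
move=> omega Gomega W WB.
have int_g := integrable_bounded_off_null mM M_null (mPhi W WB)
  (fun t => g_le W t WB).
have NR : 0 < N%:R :> R by rewrite ltr0n.
have sN : 0 < Num.sqrt N%:R :> R by rewrite sqrtr_gt0.
rewrite -[leLHS]fineK ?lee_fin; last exact: integrable_fin_num int_g.
have := devG omega W Gomega WB.
(* The deviation is a sum over the sample; dividing by [N] gives the difference of true and
   empirical loss and turns [sqrt N] into [1 / sqrt N]. *)
rewrite sumrB sumr_const card_ord -[_ *+ N]mulr_natl lerBlDr.
rewrite -ler_pdivlMl //; move/le_trans; apply.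
rewrite mulrDr mulrDr addrC addrA lerD // ?lerD //.
  rewrite -{1}(sqr_sqrtr (ltW NR)) le_eqVlt; apply/orP; left; apply/eqP.
  by field; rewrite gt_eqF.
have z_ge0 : 0 <= 2 * ln (2 / delta) by rewrite mulr_ge0.
rewrite !(sqrtrM _ z_ge0) (sqrtrV (ltW NR)) -{1}(sqr_sqrtr (ltW NR)).
by rewrite le_eqVlt; apply/orP; left; apply/eqP; field; rewrite gt_eqF.
Qed.
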